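(* Let $\mathcal{Q}=(Q,\&)$ be a meet continuous quantale. Then for every $\mathcal{Q}$-ordered set $A$, every forward Cauchy ideal of $A$ is a flat ideal of $A$.
   Context: A quantale $\mathcal{Q}=(Q,\&)$ is always assumed integral and commutative: $Q$ is a complete lattice (bottom $0$, top $1$) and $\&$ is a commutative associative operation on $Q$ with unit $1$ that distributes over arbitrary joins. $\mathcal{Q}$ is meet continuous if $a\wedge\bigvee D=\bigvee_{d\in D}(a\wedge d)$ for all $a\in Q$ and all directed $D\subseteq Q$. A $\mathcal{Q}$-ordered set is a set $A$ with a map $A(-,-):A\times A\to Q$ such that $A(x,x)=1$ and $A(y,z)\&A(x,y)\le A(x,z)$ for all $x,y,z\in A$. A fuzzy lower set of $A$ is a map $\phi:A\to Q$ with $\phi(y)\&A(x,y)\le\phi(x)$ for all $x,y$; a fuzzy upper set is a map $\psi:A\to Q$ with $A(x,y)\&\psi(x)\le\psi(y)$ for all $x,y$. Meets of maps $A\to Q$ are pointwise. For a fuzzy lower set $\phi$ and a fuzzy upper set $\psi$, $\phi\otimes\psi=\bigvee_{x\in A}\phi(x)\&\psi(x)\in Q$. A map $\lambda:A\to Q$ is inhabited if $\bigvee_{a\in A}\lambda(a)=1$. A net $\{x_i\}$ in $A$ is forward Cauchy if $\bigvee_i\bigwedge_{i\le j\le k}A(x_j,x_k)=1$. A fuzzy lower set $\phi$ of $A$ is a forward Cauchy ideal if $\phi=\bigvee_i\bigwedge_{j\ge i}A(-,x_j)$ for some forward Cauchy net $\{x_i\}$ in $A$. A fuzzy lower set $\phi$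 is a flat ideal if it is inhabited and $\phi\otimes(\psi_1\wedge\psi_2)=(\phi\otimes\psi_1)\wedge(\phi\otimes\psi_2)$ for all fuzzy upper sets $\psi_1,\psi_2$ of $A$. *)

(* Defs.v *)
From HB Require Import structures.
From mathcomp Require Import all_boot all_order.
From mathcomp Require Import mathcomp_extra boolp classical_sets.

Set Implicit Arguments.
Unset Strict Implicit.
Unset Printing Implicit Defensive.

Local Open Scope order_scope.
Local Open Scope classical_set_scope.

(* The default values make these total; they are also the join and the meet of
   the empty set, so both are the genuine operations in a complete lattice. *)
Definition bigjoin d (Q : tbLatticeType d) (S : set Q) : Q :=
  supremum (\bot : Q) S.
Definition bigmeet d (Q : tbLatticeType d) (S : set Q) : Q :=
  infimum (\top : Q) S.

HB.mixin Record isComplete d Q of Order.TBLattice d Q := {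
  supremums_neq0 : forall S : set Q, supremums S !=set0
}.

#[short(type="completeLatticeType")]
HB.structure Definition CompleteLattice d :=
  {Q of Order.TBLattice d Q & isComplete d Q}.

HB.mixin Record hasQuantaleMul d Q of CompleteLattice d Q := {
  qmul : Q -> Q -> Q;
  qmulA : associative qmul;
  qmulC : commutative qmul;
  qmul1 : left_id (\top : Q) qmul;
  qmul_bigjoinr : forall (a : Q) (S : set Q),
    qmul a (bigjoin S) = bigjoin [set qmul a s | s in S]
}.

#[short(type="quantaleType")]
HB.structure Definition Quantale d :=
  {Q of CompleteLattice d Q & hasQuantaleMul d Q}.

Notation "a ** b" := (qmul a b) (at level 40, left associativity).

Definition directed_set d (Q : porderType d) (D : set Q) : Prop :=
  D !=set0 /\
  forall a b, D a -> D b -> exists c, [/\ D c, a <= c & b <= c].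

Definition meet_continuous d (Q : completeLatticeType d) : Prop :=
  forall (a : Q) (D : set Q), directed_set D ->
    Order.meet a (bigjoin D) = bigjoin [set Order.meet a x | x in D].

Record qOrderedSet d (Q : quantaleType d) := QOrderedSet {
  qcarrier :> Type;
  qhom : qcarrier -> qcarrier -> Q;
  qhom_refl : forall x, qhom x x = \top;
  qhom_trans : forall x y z, qhom y z ** qhom x y <= qhom x z
}.

Section QOrderedSets.
Context d (Q : quantaleType d) (A : qOrderedSet Q).

Definition fuzzy_lower_set (phi : A -> Q) : Prop :=
  forall x y, phi y ** qhom x y <= phi x.

Definition fuzzy_upper_set (psi : A -> Q) : Prop :=
  forall x y, qhom x y ** psi x <= psi y.

Definition fuzzy_meet (f g : A -> Q) : A -> Q :=
  fun x => Order.meet (f x) (g x).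

Definition fuzzy_tensor (phi psi : A -> Q) : Q :=
  bigjoin [set phi x ** psi x | x in [set: A]].

Definition inhabited_fuzzy (f : A -> Q) : Prop :=
  bigjoin [set f a | a in [set: A]] = \top.

Definition flat_ideal (phi : A -> Q) : Prop :=
  [/\ fuzzy_lower_set phi,
      inhabited_fuzzy phi
    & forall psi1 psi2, fuzzy_upper_set psi1 -> fuzzy_upper_set psi2 ->
        fuzzy_tensor phi (fuzzy_meet psi1 psi2) =
        Order.meet (fuzzy_tensor phi psi1) (fuzzy_tensor phi psi2)].

End QOrderedSets.

(* Index sets of nets: nonempty directed preorders, not necessarily
   antisymmetric. *)
Record directedPreorder := DirectedPreorder {
  dcarrier :> Type;
  dle : dcarrier -> dcarrier -> Prop;
  dle_refl : forall i, dle i i;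
  dle_trans : forall i j k, dle i j -> dle j k -> dle i k;
  dnonempty : exists i : dcarrier, True;
  dle_directed : forall i j, exists k, dle i k /\ dle j k
}.

Section ForwardCauchy.
Context d (Q : quantaleType d) (A : qOrderedSet Q).

Definition forward_cauchy (I : directedPreorder) (x : I -> A) : Prop :=
  bigjoin [set bigmeet [set qhom (x jk.1) (x jk.2) |
                         jk in [set jk | dle i jk.1 /\ dle jk.1 jk.2]] |
            i in [set: I]] = \top.

Definition net_ideal (I : directedPreorder) (x : I -> A) : A -> Q :=
  fun a => bigjoin [set bigmeet [set qhom a (x j) | j in [set j | dle i j]] |
                     i in [set: I]].

Definition forward_cauchy_ideal (phi : A -> Q) : Prop :=
  fuzzy_lower_set phi /\
  exists (I : directedPreorder) (x : I -> A),
    forward_cauchy x /\ phi = net_ideal x.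

End ForwardCauchy.

(* Main.v *)
Require Import Defs.
From mathcomp Require Import all_boot all_order.
From mathcomp Require Import boolp classical_sets.

(** Let the fuzzy lower set [phi] be the ideal of a forward Cauchy net [x].
The point is that tensoring with [phi] computes a lower limit along the net:
for every fuzzy upper set [psi],
<<
  phi ⊗ psi = liminf_j psi (x j) = ⋁_i ⋀_{j >= i} psi (x j).
>>
The inequality from left to right ([net_ideal_tensor_le_liminf]) holds for any
net: a lower bound of the values A(a, x_j) over a tail, multiplied by
[psi a], is a lower bound of the values [psi (x j)] over the same tail.  The
converse ([liminf_le_net_ideal_tensor]) uses the Cauchy condition: since the
tail meets ⋀_{i <= j <= k} A(x_j, x_k) have join 1, a tail meet of
[psi (x j)] is the join of its products with them, and each such product lies,
for [l] far enough in the net, below [phi (x l)] & [psi (x l)].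

So flatness says that lower limits commute with binary meets.  Tail meets
commute with binary meets in any complete lattice, and they form a monotone
family indexed by a directed set; meet continuity is what allows the binary
meet to pass through the two directed joins ([meet_liminf]).  Inhabitation
comes again from the Cauchy condition, whose tail meets lie below the values
[phi (x i)]. *)

Set Implicit Arguments.
Unset Strict Implicit.
Unset Printing Implicit Defensive.

Import Order.TTheory.

Local Open Scope order_scope.
Local Open Scope classical_set_scope.

Section CompleteLatticeBounds.
Context d (Q : completeLatticeType d).
Implicit Types (S : set Q) (q s : Q).

Lemma bigjoin_supremums S : supremums S (bigjoin S).
Proof.
rewrite /bigjoin /supremum; case: eqP => [->|_].
  by split=> [s []|q _]; exact: le0x.
by case: (supremums_neq0 S) => s Ss; case: xgetP => [//|/(_ s)].
Qed.

Lemma bigmeet_infimums S : infimums S (bigmeet S).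
Proof.
rewrite /bigmeet /infimum; case: eqP => [->|_].
  by split=> [s []|q _]; exact: lex1.
(* Meets come from joins: the join of all lower bounds is itself one. *)
case: (supremums_neq0 (lbound S)) => s [ubs lbs].
have Ss : infimums S s by split=> // t St; apply: lbs => r; exact.
by case: xgetP => [//|/(_ s)].
Qed.

Lemma le_bigjoin S s : S s -> s <= bigjoin S.
Proof. exact: (bigjoin_supremums S).1. Qed.

Lemma bigjoin_le S q : (forall s, S s -> s <= q) -> bigjoin S <= q.
Proof. exact: (bigjoin_supremums S).2. Qed.

Lemma bigmeet_le S s : S s -> bigmeet S <= s.
Proof. exact: (bigmeet_infimums S).1. Qed.

Lemma le_bigmeet S q : (forall s, S s -> q <= s) -> q <= bigmeet S.
Proof. exact: (bigmeet_infimums S).2. Qed.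

End CompleteLatticeBounds.

Section LowerLimits.
Context d (Q : completeLatticeType d) (I : directedPreorder).
Implicit Types (f g : I -> Q) (i j : I).

Definition tail_meet f i : Q := bigmeet [set f j | j in [set j | dle i j]].

(** The net ideal of [x] at a point [a] is, by conversion, the lower limit of
[fun j => qhom a (x j)]; this lets the lemmas on lower limits apply to it. *)
Definition net_liminf f : Q := bigjoin [set tail_meet f i | i in [set: I]].

Lemma tail_meet_le f i j : dle i j -> tail_meet f i <= f j.
Proof. by move=> ij; apply: bigmeet_le; exists j. Qed.

Lemma le_tail_meet f i q : (forall j, dle i j -> q <= f j) -> q <= tail_meet f i.
Proof. by move=> qf; apply: le_bigmeet => _ [j ij <-]; exact: qf. Qed.

Lemma tail_meet_homo f i j : dle i j -> tail_meet f i <= tail_meet f j.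
Proof.
move=> ij; apply: le_tail_meet => k jk.
exact/tail_meet_le/(dle_trans ij).
Qed.

Lemma tail_meet_le_liminf f i : tail_meet f i <= net_liminf f.
Proof. by apply: le_bigjoin; exists i. Qed.

Lemma tail_meet_directed f : directed_set [set tail_meet f i | i in [set: I]].
Proof.
split; first by case: (dnonempty I) => i _; exists (tail_meet f i), i.
move=> _ _ [i _ <-] [j _ <-]; have [k [ik jk]] := dle_directed i j.
by exists (tail_meet f k); split; [exists k | exact: tail_meet_homo..].
Qed.

(** Meet continuity, applied once in each argument, turns the meet of the two
lower limits into a join over pairs of indices; each pair is dominated by a
common upper bound, so the diagonal pairs suffice. *)
Lemma meet_liminf (hQ : meet_continuous Q) f g :
  (net_liminf f `&` net_liminf g)%O <= net_liminf (fun i => f i `&` g i)%O.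
Proof.
rewrite [leLHS]hQ; last exact: tail_meet_directed.
apply: bigjoin_le => _ [_ [j _ <-] <-].
rewrite meetC [leLHS]hQ; last exact: tail_meet_directed.
apply: bigjoin_le => _ [_ [i _ <-] <-].
have [k [ik jk]] := dle_directed i j.
apply: le_trans (tail_meet_le_liminf _ k); apply: le_tail_meet => l kl.
rewrite meetC; apply: leI2; apply: tail_meet_le.
  exact: dle_trans kl.
exact: dle_trans kl.
Qed.

End LowerLimits.

Section QuantaleMultiplication.
Context d (Q : quantaleType d).
Implicit Types a b c : Q.

(** If [b <= c], then [c] is the join of [b] and [c], so distributivity makes
[a ** c] a join with [a ** b] among its terms. *)
Lemma qmul_le2l a b c : b <= c -> a ** b <= a ** c.
Proof.
move=> bc; have -> : c = bigjoin [set b; c].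
  apply/eqP; rewrite eq_le le_bigjoin /=; last by right.
  by apply: bigjoin_le => _ [] ->.
by rewrite qmul_bigjoinr; apply: le_bigjoin; exists b => //; left.
Qed.

Lemma qmul_le2 a b c e : a <= b -> c <= e -> a ** c <= b ** e.
Proof.
move=> ab ce; apply: le_trans (qmul_le2l b ce).
by rewrite qmulC [b ** c]qmulC qmul_le2l.
Qed.

End QuantaleMultiplication.

Section NetIdeals.
Context d (Q : quantaleType d) (A : qOrderedSet Q).
Context (I : directedPreorder) (x : I -> A).
Implicit Type psi : A -> Q.

Lemma le_fuzzy_tensor (phi psi : A -> Q) a :
  phi a ** psi a <= fuzzy_tensor phi psi.
Proof. by apply: le_bigjoin; exists a. Qed.

Lemma fuzzy_tensor_homo (phi psi1 psi2 : A -> Q) :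
  (forall a, psi1 a <= psi2 a) -> fuzzy_tensor phi psi1 <= fuzzy_tensor phi psi2.
Proof.
move=> le12; apply: bigjoin_le => _ [a _ <-].
exact: le_trans (qmul_le2l _ (le12 a)) (le_fuzzy_tensor _ _ a).
Qed.

Definition cauchy_tail (i : I) : Q :=
  bigmeet [set qhom (x jk.1) (x jk.2) |
            jk in [set jk | dle i jk.1 /\ dle jk.1 jk.2]].

Lemma cauchy_tail_le i j k :
  dle i j -> dle j k -> cauchy_tail i <= qhom (x j) (x k).
Proof. by move=> ij jk; apply: bigmeet_le; exists (j, k). Qed.

(** The tail starting at [l] already contributes to the ideal at [x l] the meet
of the A(x_l, x_j) for [j] above [l], all of which the Cauchy tail bounds. *)
Lemma cauchy_tail_le_net_ideal i l :
  dle i l -> cauchy_tail i <= net_ideal x (x l).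
Proof.
move=> il; apply: le_trans (tail_meet_le_liminf (fun j => qhom (x l) (x j)) l).
by apply: le_tail_meet => j lj; exact: cauchy_tail_le.
Qed.

Lemma net_ideal_inhabited : forward_cauchy x -> inhabited_fuzzy (net_ideal x).
Proof.
move=> cx; apply/eqP; rewrite eq_le lex1 /= -cx.
apply: bigjoin_le => _ [i _ <-].
apply: le_trans (cauchy_tail_le_net_ideal (dle_refl i)) _.
by apply: le_bigjoin; exists (x i).
Qed.

(** A product distributes over the join defining the ideal at [a], and
upperness of [psi] carries each A(a, x_j) & psi(a) below psi(x_j). *)
Lemma net_ideal_tensor_le_liminf psi : fuzzy_upper_set psi ->
  fuzzy_tensor (net_ideal x) psi <= net_liminf (psi \o x).
Proof.
move=> upsi; apply: bigjoin_le => _ [a _ <-].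
rewrite qmulC qmul_bigjoinr; apply: bigjoin_le => _ [_ [i _ <-] <-].
apply: le_trans (tail_meet_le_liminf _ i); apply: le_tail_meet => j ij.
rewrite qmulC; apply: le_trans (upsi a (x j)).
apply: qmul_le2 (lexx _).
exact: (tail_meet_le (fun j => qhom a (x j))).
Qed.

(** The Cauchy join is the unit, so inserting it as a factor splits a tail meet
into products with Cauchy tails; past an index [l] above both tails, the two
factors are bounded by the values of [psi] and of the ideal at the single point
[x l]. *)
Lemma liminf_le_net_ideal_tensor psi : forward_cauchy x ->
  net_liminf (psi \o x) <= fuzzy_tensor (net_ideal x) psi.
Proof.
move=> cx; apply: bigjoin_le => _ [i _ <-].
rewrite -[tail_meet _ i]qmul1 -cx qmulC qmul_bigjoinr.
apply: bigjoin_le => _ [_ [k _ <-] <-].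
have [l [il kl]] := dle_directed i k.
apply: le_trans (le_fuzzy_tensor _ _ (x l)); rewrite qmulC.
apply: qmul_le2; first exact: cauchy_tail_le_net_ideal.
exact: (tail_meet_le (psi \o x)).
Qed.

End NetIdeals.

Theorem theorem3p15 (d : Order.disp_t) (Q : quantaleType d)
    (hQ : meet_continuous Q) (A : qOrderedSet Q) (phi : A -> Q)
    (hphi : forward_cauchy_ideal phi) :
  flat_ideal phi.
Proof.
case: hphi => lphi [I [x [cx phiE]]]; split=> //.
  by rewrite phiE; exact: net_ideal_inhabited.
move=> psi1 psi2 up1 up2; apply/eqP; rewrite eq_le; apply/andP; split.
  rewrite lexI; apply/andP; split; apply: fuzzy_tensor_homo => a.
    exact: leIl.
  exact: leIr.
rewrite phiE.
apply: le_trans (liminf_le_net_ideal_tensor (fuzzy_meet psi1 psi2) cx).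
apply: le_trans (meet_liminf hQ (psi1 \o x) (psi2 \o x)).
by apply: leI2; exact: net_ideal_tensor_le_liminf.
Qed.
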